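(* Let $G/P$ be cominuscule. A rectangular array of straight shapes in $\mathbb{Y}_{G/P}$ is a growth diagram if and only if for any $2\times2$ subgrid (of adjacent rows and columns) $$\begin{array}{|c|c|}\hline \alpha&\beta\\ \hline \gamma&\delta\\ \hline\end{array}$$ the following Fomin growth conditions hold: (F0) $\alpha/\gamma$, $\delta/\gamma$, $\beta/\alpha$ and $\beta/\delta$ each consist of a single box; (F1) if $\alpha$ is the unique shape (strictly) containing $\gamma$ and (strictly) contained in $\beta$, then $\delta=\alpha$; (F2) otherwise there is a unique such shape other than $\alpha$, and this shape is $\delta$.
   Context: $G$ is a complex connected reductive Lie group with root system $\Phi$, positive roots $\Phi^+$, simple roots $\Delta$; $P$ is a maximal parabolic subgroup associated to a simple root $\beta(P)$ that is cominuscule, i.e. if $\beta(P)$ occurs in the simple root expansion of $\gamma\in\Phi^+$ it does so with coefficient one. Then $G/P$ is called cominuscule. Order $\Phi^+$ by the transitive closure of the covering relations $\alpha\prec\gamma$ if $\gamma-\alpha\in\Delta$. Let $\Lambda_{G/P}\subseteq\Phi^+$ be the subposet of positive roots containing $\beta(P)$ in their simple root expansion; its elements are called boxes. Straight shapes are the lower order ideals of $\Lambda_{G/P}$; their set is $\mathbb{Y}_{G/P}$. For $\lambda\subseteq\nu$ in $\mathbb{Y}_{G/P}$, $\nu/\lambda$ is the set difference (skew shape); writing $\nu/\lambda$ presupposes $\lambda\subseteq\nu$. A standard tableau of shape $\nu/\lambda$ is a bijection $\mathrm{label}:\nu/\lambda\to\{1,\dots,|\nu/\lambda|\}$ with $\mathrm{label}(x)<\mathrm{label}(y)$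 whenever $x\prec y$. Such a tableau is equivalently a shape chain, a sequence of straight shapes from $\lambda$ to $\nu$, each successive shape having one more box than the one before: the $j$-th shape after $\lambda$ consists of $\lambda$ together with the boxes labelled at most $j$. Jeu de taquin slide of a tableau $T$ of shape $\nu/\lambda$ into a maximal box $x$ of $\lambda$: among the boxes of $\nu/\lambda$ covering $x$, let $y$ be the one with smallest label; move $\mathrm{label}(y)$ to $x$, leaving $y$ vacant; then move into $y$ the smallest label among boxes of $\nu/\lambda$ covering $y$; repeat until no further move is possible. (If no box of $\nu/\lambda$ covers $x$, the slide leaves the labels where they are.) Rectifying $T$ means iterating slides until a tableau of straight shape results. Growth diagram: take a standard tableau $T$ of skew shape $\nu/\lambda$ and a rectification sequence of $T$, the order of the slides being described by a standard tableau $A$ of shape $\lambda$: the slides are made into the boxes of $A$ in decreasing order of label. Put the shape chain of $T$ atop the shape chains of the successive tableaux produced in the course of rectifying $T$, where the shape chain of the tableau obtained when only the boxes of $A$ with labels at most $i$ remain to be slid into begins at the straight shape formed by those boxes. The resulting two-dimensional array of straight shapes is called a growth diagram; its top row is the shape chain of $T$ and its left column is the shape chain of $A$.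
   Formalization: The array is assumed to have at least two rows and two columns and the empty shape as its bottom-left entry; without this the local conditions do not imply being a growth diagram, whose left column is by definition a shape chain starting at the empty shape. *)

(* Defs.v *)
From HB Require Import structures.
From mathcomp Require Import all_boot all_order all_algebra.
From mathcomp Require Import finmap.

Set Implicit Arguments.
Unset Strict Implicit.
Unset Printing Implicit Defensive.

Import Order.TTheory GRing.Theory Num.Theory.
Local Open Scope ring_scope.

(* A complex connected reductive group G with a cominuscule maximal parabolic P
   enters only through its root system, its simple roots and beta(P).  Every
   tuple (Phi, Delta, beta(P)) as below arises in this way.  The roots are not
   required to span V, since G is only reductive. *)

Definition reduced_root_system (R : archiRealFieldType) (V : vectType R)
    (dot : {dot V for idfun}) (Phi : {fset V}) : Prop :=
  [/\ 0 \notin Phi,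
      {in Phi & Phi, forall a b, b - (2 * dot b a / dot a a) *: a \in Phi},
      {in Phi & Phi, forall a b, 2 * dot b a / dot a a \is a Num.int}
    & {in Phi, forall a (c : R), c *: a \in Phi -> c = 1 \/ c = -1}].

Definition simple_roots (R : archiRealFieldType) (V : vectType R)
    (Phi : {fset V}) (r : nat) (Delta : r.-tuple V) : Prop :=
  [/\ {subset Delta <= Phi},
      free Delta
    & {in Phi, forall c, c \in <<Delta>>%VS /\
        ((forall i, coord Delta i c \is a Num.nat) \/
         (forall i, - coord Delta i c \is a Num.nat))}].

Section Cominuscule.

Variables (R : archiRealFieldType) (V : vectType R) (Phi : {fset V}).
Variables (r : nat) (Delta : r.-tuple V).

Definition positive_roots : {fset V} :=
  [fset c in Phi | [forall i, coord Delta i c \is a Num.nat]]%fset.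

Definition root_covers (x y : positive_roots) : bool := val y - val x \in Delta.

Definition root_le : rel positive_roots := connect root_covers.

Definition root_lt : rel positive_roots := fun x y => (x != y) && root_le x y.

(* beta(P) is the simple root of index k. *)
Variable k : 'I_r.

Definition cominuscule : Prop :=
  {in positive_roots, forall c,
    coord Delta k c != 0 -> coord Delta k c = 1}.

Definition boxes : {set positive_roots} :=
  [set x : positive_roots | coord Delta k (val x) != 0].

Definition lower_ideal (l : {set positive_roots}) : bool :=
  (l \subset boxes) &&
  [forall x in boxes, forall y in l, root_le x y ==> (x \in l)].

Record straight_shape := StraightShape {
  shape_set :> {set positive_roots};
  _ : lower_ideal shape_set
}.

HB.instance Definition _ := [isSub for shape_set].

(* The label 0 encodes the absence of a label. *)
Definition tableau := {ffun positive_roots -> nat}.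

Definition standard_tableau (S : {set positive_roots}) (T : tableau) : Prop :=
  [/\ forall x, x \notin S -> T x = 0%N,
      perm_eq [seq T x | x in S] (iota 1 #|S|)
    & {in S &, forall x y, root_lt x y -> (T x < T y)%N}].

Definition label_le (T : tableau) (j : nat) : {set positive_roots} :=
  [set x | (0 < T x <= j)%N].

Definition move_label (T : tableau) (y x : positive_roots) : tableau :=
  [ffun z => if z == x then T y else if z == y then 0%N else T z].

(* [slide T x T']: the jeu de taquin slide of T into the vacant box x ends in
   the tableau T'. *)
Inductive slide : tableau -> positive_roots -> tableau -> Prop :=
| SlideStop (T : tableau) (x : positive_roots) :
    (forall y, root_covers x y -> T y = 0%N) -> slide T x T
| SlideMove (T : tableau) (x y : positive_roots) (T' : tableau) :
    root_covers x y -> T y != 0%N ->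
    (forall z, root_covers x z -> T z != 0%N -> (T y <= T z)%N) ->
    slide (move_label T y x) y T' -> slide T x T'.

(* Rows are numbered from the top.  [Ts i] is the tableau obtained from
   [T = Ts 0] after i slides; the next slide is into the box that A labels
   m - i, and the boxes still to be slid into are those with smaller or equal
   labels. *)
Definition growth_diagram (m n : nat)
    (g : 'M[straight_shape]_(m.+1, n.+1)) : Prop :=
  exists (lam nu : straight_shape) (T A : tableau) (Ts : nat -> tableau),
    [/\ [/\ lam \subset nu, #|lam| = m & #|nu :\: lam| = n],
        standard_tableau (nu :\: lam) T,
        standard_tableau lam A,
        Ts 0%N = T /\
        (forall i x, (i < m)%N -> A x = (m - i)%N -> slide (Ts i) x (Ts i.+1))
      & forall i j,
          g i j = label_le A (m - i) :|: label_le (Ts i) j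
            :> {set positive_roots}].

Definition one_box (l u : straight_shape) : Prop :=
  l \subset u /\ #|u :\: l| = 1%N.

Definition strictly_between (l u s : straight_shape) : Prop :=
  l \proper s /\ s \proper u.

(* The 2 x 2 block with top row (al, be) and bottom row (ga, de). *)
Definition fomin_conditions (al be ga de : straight_shape) : Prop :=
  [/\ [/\ one_box ga al, one_box ga de, one_box al be & one_box de be],
      unique (strictly_between ga be) al -> de = al
    & ~ unique (strictly_between ga be) al ->
      unique (fun s => strictly_between ga be s /\ s <> al) de].

End Cominuscule.

(* Main.v *)
Require Import Defs.
From mathcomp Require Import all_boot all_order all_algebra.
From mathcomp Require Import finmap.
From mathcomp Require Import zify.

Set Implicit Arguments.
Unset Strict Implicit.
Unset Printing Implicit Defensive.

(** The argument takes place in the poset of boxes.  A row of the array is a saturated chain of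
lower ideals [c 0, ..., c n], and such chains are the same thing as standard
tableaux ([chain_tableau_labels], [standard_chain_labels],
[standard_growing]).  Let [T] be the tableau of [c].  While a slide of [T] runs,
the hole [p j] reached once the labels at most [j] have had their chance to
move obeys a one-step rule: if [b] is the box with label [j + 1], that is, the
box added between [c j] and [c j.+1], then [p j.+1] is [b] if [b] covers [p j],
and is [p j] otherwise.  At that moment the labels at most [j] of the new tableau are
in place, and together with the smaller initial shape [c 0 :\ p 0] they fill
[c j :\ p j]; so this is the chain of the new tableau.  This is [slide_vacated], together with [slide_chain_labels], which adds that a slide has
only one outcome.

The Fomin conditions on a square encode the same rule.  Put [ga = al :\ p]
and [be = b |: al].  The interval from [ga] to [be] has two boxes, [p] and
[b], so its middle elements are [al] and, when it is an ideal, [be :\ p].  It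
is an ideal exactly when [b] does not cover [p]: any chain of covers from [p] to
[b] starts with a box of [be], which must be [b] itself since [ga] is an ideal
without [p] ([ideal_swap]).  So the conditions say that [de] is [be] without the
next hole ([fominP]).  By induction along the row, all squares between two rows
satisfy them iff the lower row is the chain obtained by the slide
([fomin_vacated]), and the theorem is this equivalence applied to each pair of
consecutive rows.  The boxes slid into are read off the left column, which is the
chain of [A] listed from bottom to top. *)

(** * Saturated chains of finite sets *)

Section Chains.

Variable E : finType.
Implicit Types (c : nat -> {set E}) (n : nat).

Definition growing n c : Prop :=
  forall j, j < n -> c j \subset c j.+1 /\ #|c j.+1 :\: c j| = 1.

(** The default [x] makes this a total function of [j]; it is returned only past
the end of a growing chain. *)
Definition new_box (x : E) c j : E :=
  odflt x [pick z in c j.+1 :\: c j].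

Lemma cards_setDD1 (S : {set E}) p : p \in S -> #|S :\: (S :\ p)| = 1.
Proof. by move=> pS; rewrite setDDr setDv set0U (setIidPr _) ?cards1 ?sub1set. Qed.

Lemma cards_setU1D (S : {set E}) b p : b \notin S -> b != p ->
  #|((b |: S) :\ p) :\: (S :\ p)| = 1.
Proof.
move=> bS nbp; rewrite -(cards1 b); congr #|pred_of_set _|; apply/setP=> z.
rewrite !inE; case: (eqVneq z p) => [-> | _] /=; first by rewrite eq_sym (negPf nbp).
by case: (eqVneq z b) => [-> | _]; rewrite ?bS //= andNb.
Qed.

Lemma growingS n c i j : growing n c -> i <= j -> j <= n -> c i \subset c j.
Proof.
move=> cG /subnK <-; elim: (j - i) => // d IHd; rewrite addSn => lt_n.
have [sub _] := cG _ lt_n.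
exact: subset_trans (IHd (ltnW lt_n)) sub.
Qed.

Lemma growing_ext n c c' : (forall j, j <= n -> c j = c' j) ->
  growing n c -> growing n c'.
Proof. by move=> eq_c cG j lt_jn; rewrite -!eq_c ?(ltnW lt_jn) //; apply: cG. Qed.

Lemma new_boxP n c x j : growing n c -> j < n ->
  new_box x c j \notin c j /\ c j.+1 = new_box x c j |: c j.
Proof.
move=> cG /cG[sub /eqP/cards1P[b cb]].
have -> : new_box x c j = b.
  rewrite /new_box; case: pickP => [z | /(_ b)] /=; rewrite cb in_set1.
    by move/eqP.
  by rewrite eqxx.
have [_ nb] : b \in c j.+1 /\ b \notin c j by apply/setDP; rewrite cb set11.
split=> //; rewrite -(setID (c j.+1) (c j)) (setIidPr sub) setUC.
by congr (_ :|: _).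
Qed.

Lemma growing_card n c : growing n c -> #|c n :\: c 0| = n.
Proof.
move=> cG; suff H j : j <= n -> #|c j :\: c 0| = j by exact: H.
elim: j => [_ | j IHj lt_jn]; first by rewrite setDv cards0.
have [sub card1] := cG _ lt_jn.
have sub0 := growingS cG (leq0n j) (ltnW lt_jn).
rewrite cardsD (setIidPr (subset_trans sub0 sub)).
have := card1; rewrite cardsD (setIidPr sub).
have := IHj (ltnW lt_jn); rewrite cardsD (setIidPr sub0).
move: (subset_leq_card sub0) (subset_leq_card sub); lia.
Qed.

End Chains.

(** * Standard tableaux as chains of shapes *)

Section Tableaux.

Variables (R : archiRealFieldType) (V : vectType R).
Variables (Phi : {fset V}%fset) (r : nat) (Delta : r.-tuple V) (k : 'I_r).

Local Notation root := (positive_roots Phi Delta).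
Local Notation cov := (@root_covers R V Phi r Delta).
Local Notation ideal := (@lower_ideal R V Phi r Delta k).
Implicit Types (x y z : root) (S : {set root}) (T : tableau Phi Delta).
Implicit Types (c : nat -> {set root}) (n : nat).

Lemma ideal_boxes S x : ideal S -> x \in S -> x \in boxes Phi Delta k.
Proof. by case/andP=> /subsetP sub _; exact: sub. Qed.

Lemma ideal_le S x y : ideal S -> x \in boxes Phi Delta k -> y \in S ->
  root_le x y -> x \in S.
Proof. by case/andP=> _ /forall_inP H xB /(forall_inP (H x xB)) /implyP; apply. Qed.

Lemma ideal_covers S x y : ideal S -> x \in boxes Phi Delta k -> y \in S ->
  cov x y -> x \in S.
Proof. by move=> iS xB yS cxy; apply: (ideal_le iS xB yS); apply: connect1. Qed.

(** A box is labelled by the first index at which it enters the chain, so the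
boxes of [c 0] get 0, the mark of an unlabelled box. *)
Definition chain_tableau n c : tableau Phi Delta :=
  [ffun x => if x \in c n then
     [arg min_(i < (ord_max : 'I_n.+1) | x \in c i) (i : nat)] : nat else 0].

(** The relation between a tableau and its shape chain, on the indices up to [n]
only; the bound on labels is what makes [T] determined by [c]. *)
Definition chain_labels n c T : Prop :=
  (forall x, T x <= n) /\ (forall j, j <= n -> label_le T j = c j :\: c 0).

Lemma label_le0 T : label_le T 0 = set0.
Proof. by apply/setP=> z; rewrite !inE; case: (T z). Qed.

Lemma chain_labels_ext n c c' T : (forall j, j <= n -> c j = c' j) ->
  chain_labels n c T -> chain_labels n c' T.
Proof.
by move=> eq_c [leT labT]; split=> // j le_jn; rewrite -!eq_c // labT.
Qed.

Lemma chain_labels_le n c T x j : chain_labels n c T -> j <= n ->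
  (0 < T x <= j) = (x \in c j) && (x \notin c 0).
Proof.
by move=> [_ H] /H/setP/(_ x); rewrite !inE andbC => ->; rewrite andbC.
Qed.

Lemma chain_labels_eq0 n c T x : chain_labels n c T -> x \in c 0 -> T x = 0.
Proof.
move=> TL x0; apply/eqP; rewrite -leqn0 leqNgt; apply/negP=> Tx.
have := chain_labels_le x TL (leqnn n).
by rewrite Tx x0 TL.1 andbF.
Qed.

Section Chain.

Variables (n : nat) (c : nat -> {set root}).
Hypothesis c_growing : growing n c.

Lemma chain_labels_new T x j : chain_labels n c T -> j < n -> T (new_box x c j) = j.+1.
Proof.
move=> TL lt_jn; have [nb Dc] := new_boxP x c_growing lt_jn.
have nb0 : new_box x c j \notin c 0.
  by apply: contraNN nb; apply/subsetP/(growingS c_growing) => //; apply: ltnW.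
have := chain_labels_le (new_box x c j) TL lt_jn.
have := chain_labels_le (new_box x c j) TL (ltnW lt_jn).
by rewrite Dc setU11 nb0 (negPf nb) /=; lia.
Qed.

Lemma chain_labels_inj T y z : chain_labels n c T ->
  T y != 0 -> T y = T z -> y = z.
Proof.
move=> TL; rewrite -lt0n; case DT: (T y) => [//|j] _ Tz.
have lt_jn : j < n by rewrite -DT TL.1.
have [nb Dc] := new_boxP y c_growing lt_jn.
suff H u : T u = j.+1 -> u = new_box y c j by rewrite (H y DT) (H z (esym Tz)).
move=> Tu; have := chain_labels_le u TL lt_jn.
have := chain_labels_le u TL (ltnW lt_jn); rewrite Tu ltnn leqnn /=.
move=> nuc /esym/andP[uc u0].
by move: nuc; rewrite u0 andbT; move: uc; rewrite Dc => /setU1P[-> // | ->].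
Qed.

Lemma chain_tableau_labels : chain_labels n c (chain_tableau n c).
Proof.
split=> [x | j le_jn]; first by rewrite ffunE; case: ifP => // _; rewrite -ltnS.
apply/setP=> x; rewrite !inE ffunE; case: ifPn => [xn | nxn]; last first.
  rewrite andbC /=; apply/esym/negbTE; rewrite negb_and orbC; apply/orP; left.
  by apply: contraNN nxn; apply/subsetP/(growingS c_growing).
case: arg_minnP => [// | i xi mini].
congr (_ && _).
  apply/idP/idP=> [i0 | nx0].
    by apply/negP=> x0; have := mini (Ordinal (ltn0Sn n)) x0; rewrite leqNgt i0.
  by rewrite lt0n; apply: contraNneq nx0 => <-.
apply/idP/idP=> [le_ij | xj]; last first.
  by have := mini (inord j); rewrite inordK // => /(_ xj).
exact: subsetP (growingS c_growing le_ij le_jn) x xi.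
Qed.

(** Monotonicity of the labels along the root order is the fact that each member
of the chain is an ideal: it contains whatever lies below the box it has just
received. *)
Lemma standard_chain_labels T : (forall j, j <= n -> ideal (c j)) ->
  chain_labels n c T -> standard_tableau (c n :\: c 0) T.
Proof.
move=> c_ideal TL; have cardS := growing_card c_growing.
have inS x : (x \in c n :\: c 0) = (0 < T x).
  by rewrite -TL.2 // inE TL.1 andbT.
have injT : {in c n :\: c 0 &, injective T}.
  by move=> x y; rewrite !inS => Tx _; apply: chain_labels_inj; rewrite // -lt0n.
split=> [x | | x y xS yS /andP[nxy le_xy]].
- by rewrite inS lt0n negbK => /eqP.
- have uT : uniq [seq T x | x in c n :\: c 0] by apply/dinjectiveP.
  have sub : {subset [seq T x | x in c n :\: c 0] <= iota 1 #|c n :\: c 0|}.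
    move=> _ /imageP[x xS ->]; rewrite mem_iota cardS -inS xS.
    by rewrite add1n ltnS TL.1.
  apply: uniq_perm => //; first exact: iota_uniq.
  by apply: (uniq_min_size uT sub _).2; rewrite size_iota size_image.
rewrite ltn_neqAle; apply/andP; split.
  by apply: contraNneq nxy => /(injT x y xS yS) ->.
have := chain_labels_le y TL (TL.1 y).
move: xS yS; rewrite !inS => Tx Ty; rewrite Ty leqnn => /esym/andP[yc _].
have xB : x \in boxes Phi Delta k.
  by move: Tx; rewrite -inS => /setDP[xn _]; apply: (ideal_boxes (c_ideal n _)) xn.
have xc := ideal_le (c_ideal _ (TL.1 y)) xB yc le_xy.
have := chain_labels_le x TL (TL.1 y); rewrite xc Tx /= => ->.
by move: Tx; rewrite -inS => /setDP[].
Qed.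

End Chain.

(** The passage from tableau to chain, converse to [standard_chain_labels]: each
of the values 1 to [#|S|] is taken exactly once, so each step adds one box. *)
Lemma standard_growing S (l : {set root}) T :
  [disjoint l & S] -> standard_tableau S T ->
  let c := fun j => l :|: label_le T j in
  [/\ growing #|S| c, chain_labels #|S| c T & c #|S| = l :|: S].
Proof.
move=> dis [T0 Tperm _] c.
have TS z : z \in S -> 0 < T z <= #|S|.
  move=> zS; have : T z \in [seq T x | x in S] by apply: image_f.
  by rewrite (perm_mem Tperm) mem_iota add1n ltnS.
have inS z : (0 < T z) = (z \in S).
  by case: (boolP (z \in S)) => [/TS/andP[] | /T0 ->].
have le_T z : T z <= #|S| by case: (boolP (z \in S)) => [/TS/andP[] | /T0 ->].
have c0 : c 0 = l by rewrite /c label_le0 setU0.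
have cS : c #|S| = l :|: S.
  by congr (_ :|: _); apply/setP=> z; rewrite inE le_T andbT inS.
split=> //; last first.
  split=> // j _; rewrite c0 setDUl setDv set0U; apply/esym/setDidPl.
  rewrite disjoint_sym; apply: disjointWr dis; apply/subsetP=> z.
  by rewrite inE inS => /andP[].
move=> j lt_jS; split.
  by apply: setUS; apply/subsetP=> z; rewrite !inE; lia.
have /imageP[z zS Tz] : j.+1 \in [seq T x | x in S].
  by rewrite (perm_mem Tperm) mem_iota; lia.
have injT : {in S &, injective T}.
  by apply/dinjectiveP; rewrite /dinjectiveb (perm_uniq Tperm) iota_uniq.
rewrite -(cards1 z); congr #|pred_of_set _|; apply/setP=> u.
have nl v : v \in S -> v \notin l by move=> vS; rewrite (disjointFl dis vS).
rewrite in_set1 !inE; apply/idP/eqP=> [| ->].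
  move=> H; have Tu : T u = j.+1 by move: H; case: (u \in l) => //=; lia.
  by apply: injT; rewrite -?Tz // -inS Tu.
by rewrite (negPf (nl z zS)) -Tz ltnn /= leqnn.
Qed.

End Tableaux.

(** * The local rule *)

Section Slides.

Variables (R : archiRealFieldType) (V : vectType R).
Variables (Phi : {fset V}%fset) (r : nat) (Delta : r.-tuple V) (k : 'I_r).

Hypothesis free_Delta : free Delta.

Local Notation root := (positive_roots Phi Delta).
Local Notation cov := (@root_covers R V Phi r Delta).
Local Notation ideal := (@lower_ideal R V Phi r Delta k).
Implicit Types (x y z p b : root) (S : {set root}) (T : tableau Phi Delta).
Implicit Types (c : nat -> {set root}) (n : nat).

Lemma root_coversxx x : cov x x = false.
Proof.
apply/negP; rewrite /root_covers GRing.subrr => /(free_not0 free_Delta).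
by rewrite eqxx.
Qed.

(** Adding a simple root cannot cancel the coefficient of the simple root of index
[k], because coefficients of positive roots are natural numbers. *)
Lemma boxes_covers x y : cov x y -> x \in boxes Phi Delta k ->
  y \in boxes Phi Delta k.
Proof.
rewrite /root_covers !inE => /(nthP 0%R)[i lt_i Dy].
rewrite size_tuple in lt_i.
have -> : val y = (val x + Delta`_i)%R by rewrite Dy GRing.addrC GRing.subrK.
rewrite GRing.linearD /= (coord_free (Ordinal lt_i) k free_Delta).
have := valP x; rewrite !inE /= => /andP[_ /forallP/(_ k) /Num.Theory.natrP[a ->]].
rewrite -GRing.natrD !Num.Theory.pnatr_eq0 addn_eq0.
by move/negPf->.
Qed.

(** If [p] were below some [y] left in [(b |: S) :\ p], take the first cover [q]
of [p] on a chain of covers up to [y].  It belongs to the ideal [b |: S] and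
differs from [b], so it lies in the ideal [S :\ p], which would then contain
[p]. *)
Lemma ideal_swap S p b : ideal (b |: S) -> ideal (S :\ p) -> p \in S ->
  b \notin S -> ~~ cov p b -> ideal ((b |: S) :\ p).
Proof.
move=> iB iG pS bS ncov.
have pB : p \in boxes Phi Delta k by apply: (ideal_boxes iB); rewrite !inE pS orbT.
apply/andP; split.
  by apply/subsetP=> z /setD1P[_]; apply: ideal_boxes.
apply/forall_inP=> x xB; apply/forall_inP=> y /setD1P[nyp yS]; apply/implyP=> le_xy.
rewrite in_setD1 (ideal_le iB xB yS le_xy) andbT; apply/eqP=> Dx.
rewrite {}Dx {x xB} in le_xy.
have [q cpq le_qy] : exists2 q, cov p q & root_le q y.
  case/connectP: le_xy => [[|q s] /=]; first by move=> _ Dy; rewrite Dy eqxx in nyp.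
  by case/andP=> cpq qs Dy; exists q => //; apply/connectP; exists s.
have qS : q \in S :\ p.
  have := ideal_le iB (boxes_covers cpq pB) yS le_qy.
  rewrite !inE; case: eqP => [Dq | _ /= qS].
    by move: cpq; rewrite Dq (negPf ncov).
  by rewrite qS andbT; apply/eqP=> Dq; rewrite Dq root_coversxx in cpq.
by have := ideal_covers iG pB qS cpq; rewrite !inE eqxx.
Qed.

(** The hole [p] moves to the box [b] bearing the next label, or stays. *)
Definition next_vacancy p b : root := if cov p b then b else p.

(** The interval between [ga] and [be] consists of the two boxes [p] and [b], and
a shape strictly inside contains exactly one of them. *)
Lemma strictly_betweenP (al be ga s : straight_shape Phi Delta k) p b :
  p \in al -> ga = al :\ p :> {set root} ->
  b \notin al -> be = b |: al :> {set root} ->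
  strictly_between ga be s <-> s = al \/ s = be :\ p :> {set root}.
Proof.
move=> pal Dga bal Dbe; rewrite /strictly_between.
have nbp : b != p by apply: contraNneq bal => ->.
split=> [[/properP[sub1 [u us uga]] /properP[sub2 [v vbe vs]]] | [-> | Ds]].
- rewrite Dga in uga; rewrite Dbe in vbe.
  have sub1' z : z \in al -> z != p -> z \in s.
    by move=> zal nzp; apply: (subsetP sub1); rewrite Dga in_setD1 nzp.
  have sub2' z : z \in s -> (z == b) || (z \in al).
    by move=> /(subsetP sub2); rewrite Dbe in_setU1.
  case: (boolP (p \in s)) => [ps | nps]; [left | right].
    have nbs : b \notin s.
      apply: contraNN vs => bs; move: vbe; rewrite in_setU1.
      case/predU1P=> [-> // | val].
      by case: (eqVneq v p) => [-> // |]; apply: sub1'.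
    apply: val_inj; apply/setP=> z /=; apply/idP/idP=> [zs | zal].
      case/predU1P: (sub2' z zs) => // Dz.
      by rewrite Dz (negPf nbs) in zs.
    by case: (eqVneq z p) => [-> // |]; apply: sub1'.
  have bs : b \in s.
    have := sub2' u us; case/predU1P=> [<- // | ual].
    move: uga; rewrite in_setD1 ual andbT negbK => /eqP Du.
    by rewrite -Du us in nps.
  apply/setP=> z; rewrite Dbe in_setD1 in_setU1; apply/idP/andP=> [zs | [nzp]].
    by split; [apply: contraNneq nps => <- | apply: sub2'].
  by case/predU1P=> [-> // | zal]; apply: sub1'.
- by rewrite Dga Dbe properD1 //; split=> //; rewrite properUr // sub1set.
rewrite Ds properD1; last by rewrite Dbe !inE pal orbT.
split=> //; rewrite Dga Dbe; apply/properP; split.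
  by apply: setSD; apply: subsetUr.
by exists b; rewrite !inE (negPf bal) ?eqxx ?nbp ?andbF.
Qed.

(** When [b] covers [p], no ideal contains [b] without [p]; the middle shape [al]
is then unique and equals [be :\ b].  Otherwise [ideal_swap] makes [be :\ p] the
second and last middle shape. *)
Lemma fominP (al be ga de : straight_shape Phi Delta k) p b :
  p \in al -> ga = al :\ p :> {set root} ->
  b \notin al -> be = b |: al :> {set root} ->
  fomin_conditions al be ga de <-> de = be :\ next_vacancy p b :> {set root}.
Proof.
move=> pal Dga bal Dbe.
have btw s := strictly_betweenP s pal Dga bal Dbe.
have nbp : b != p by apply: contraNneq bal => ->.
have pbe : p \in be by rewrite Dbe !inE pal orbT.
have bbe : b \in be by rewrite Dbe setU11.
have beDb : be :\ b = al :> {set root} by rewrite Dbe setU1K.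
have iS (s : straight_shape Phi Delta k) : ideal s by case: s.
have ob_al : one_box al be.
  split; first by rewrite Dbe subsetUr.
  by rewrite Dbe setDUl setDv setU0 (setDidPl _) ?cards1 // disjoints1.
have ob_ga : one_box ga al.
  split; first by rewrite Dga subsetDl.
  by rewrite Dga cards_setDD1.
rewrite /next_vacancy; case: ifPn => [cpb | ncpb].
  have uniq_al : unique (strictly_between ga be) al.
    split=> [|s /btw]; first by apply/btw; left.
    case=> // Ds; have := ideal_covers (iS s) (ideal_boxes (iS be) pbe) (y := b).
    by rewrite Ds !inE nbp bbe eqxx => /(_ isT cpb).
  split=> [[_ F1 _] | ]; first by rewrite (F1 uniq_al) beDb.
  by rewrite beDb => /val_inj ->; split.
have iX : ideal (be :\ p).
  by rewrite Dbe; apply: ideal_swap; rewrite -?Dbe -?Dga.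
pose X := StraightShape iX.
have nX : X <> al.
  by move/(congr1 (fun s : straight_shape _ _ _ => p \in s)); rewrite /= pal !inE eqxx.
have btwX : strictly_between ga be X by apply/btw; right.
have nuniq : ~ unique (strictly_between ga be) al by case=> _ /(_ X btwX) /esym.
split=> [[_ _ F2] | Dde].
  by case: (F2 nuniq) => _ /(_ X (conj btwX nX)) ->.
have {Dde} -> : de = X by apply: val_inj.
split=> //; last first.
  by move=> _; split=> // s [/btw[// | Ds] _]; apply: val_inj.
split=> //; split; rewrite /= ?subsetDl ?cards_setDD1 //.
  by rewrite Dga Dbe; apply: setSD; apply: subsetUr.
by rewrite Dga Dbe cards_setU1D.
Qed.

Lemma one_box_setD1 (l u : straight_shape Phi Delta k) x : one_box l u ->
  x \in u -> x \notin l -> l = u :\ x :> {set root}.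
Proof.
move=> [sub /eqP/cards1P[y Dy]] xu xl.
have -> : x = y by apply/eqP; rewrite -in_set1 -Dy in_setD xl.
by rewrite -Dy setDDr setDv set0U; apply/esym/setIidPr.
Qed.

(** * The chain of a slid tableau *)

(** Distinct boxes carry distinct nonzero labels, so the smallest label above the
hole determines the box that moves, and moving a label keeps this property. *)
Lemma slide_deterministic T x T1 T2 :
  (forall y z, T y != 0 -> T y = T z -> y = z) ->
  slide T x T1 -> slide T x T2 -> T1 = T2.
Proof.
move=> injT sl1; elim: sl1 injT T2 =>
  {x T T1} [T x stop | T x y T1 cxy Ty miny _ IH] injT T2 sl2.
  case: {T x T2} sl2 stop {injT} => // T x y T2 cxy Ty _ _ /(_ y cxy) Ty0.
  by rewrite Ty0 in Ty.
case: {T x T2} sl2 cxy Ty miny injT IH =>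
  [T x stop | T x y2 T2 cxy2 Ty2 miny2 sl2] cxy Ty miny injT IH.
  by rewrite (stop y cxy) in Ty.
have Dy : y = y2.
  by apply: injT => //; apply/eqP; rewrite eqn_leq miny ?miny2.
rewrite -Dy in sl2; apply: IH sl2 => u v; rewrite !ffunE.
have nyx : y != x by apply: contraTneq cxy => ->; rewrite root_coversxx.
case: (eqVneq u x) (eqVneq v x) => [-> | nux] [-> | nvx] //.
- case: (eqVneq v y) => [_ /[swap] -> // | nvy _ /(injT _ _ Ty) Dv].
  by rewrite Dv eqxx in nvy.
- case: (eqVneq u y) => // nuy Tu /(injT _ _ Tu) Du.
  by rewrite Du eqxx in nuy.
case: (eqVneq u y) => // nuy; case: (eqVneq v y) => [_ /[swap] -> // | _].
exact: injT.
Qed.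

(** The position of the hole once the labels at most [j] have been considered, the
slide starting at [x]. *)
Fixpoint vacancy c x j : root :=
  if j is j'.+1 then next_vacancy (vacancy c x j') (new_box x c j') else x.

Definition vacated c x j : {set root} := c j :\ vacancy c x j.

Section Vacancy.

Variables (n : nat) (c : nat -> {set root}) (x : root).
Hypothesis c_growing : growing n c.
Hypothesis c_ideal : forall j, j <= n -> ideal (c j).
Hypothesis x_in : x \in c 0.
Hypothesis c0x_ideal : ideal (c 0 :\ x).

Lemma vacancy_ideal j : j <= n ->
  vacancy c x j \in c j /\ ideal (vacated c x j).
Proof.
elim: j => [_ | j IHj lt_jn]; first by split.
have [pc iD] := IHj (ltnW lt_jn); have [nb Dc] := new_boxP x c_growing lt_jn.
rewrite /vacated /= /next_vacancy; case: ifPn => [cpb | ncpb].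
  by rewrite Dc setU11 setU1K //; split=> //; apply: c_ideal; apply: ltnW.
rewrite Dc setU1r //; split=> //; apply: ideal_swap => //.
by rewrite -Dc; apply: c_ideal.
Qed.

(** The boxes already settled form an ideal that misses the hole, so none of them
lies above it. *)
Lemma vacancy_nle j z : j <= n -> cov (vacancy c x j) z ->
  z \notin vacated c x j.
Proof.
move=> le_jn cpz; have [pc iD] := vacancy_ideal le_jn.
apply/negP=> zD; have := ideal_covers iD (ideal_boxes (c_ideal le_jn) pc) zD cpz.
by rewrite !inE eqxx.
Qed.

Lemma vacated_growing : growing n (vacated c x).
Proof.
move=> j lt_jn; have [nb Dc] := new_boxP x c_growing lt_jn.
have [pc _] := vacancy_ideal (ltnW lt_jn).
have nbp : new_box x c j != vacancy c x j by apply: contraNneq nb => ->.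
rewrite /vacated /= /next_vacancy; case: ifPn => [cpb | ncpb].
  by rewrite Dc setU1K // subsetDl; split=> //; apply: cards_setDD1.
by rewrite Dc setSD ?subsetUr //; split=> //; apply: cards_setU1D.
Qed.

End Vacancy.

(** The slide is followed through the intermediate tableaux [S j], in which the
labels at most [j] are already in their final position, the hole is at
[vacancy c x j], and the labels above [j] have not moved.  Passing from [j] to
[j + 1] is one move of the slide if the box labelled [j + 1] covers the hole, and
leaves [S j] unchanged otherwise.  Since [slide] is built from its last move
backwards, the induction goes from [n] down to 0. *)
Lemma slide_vacated n c x T T' : growing n c ->
  (forall j, j <= n -> ideal (c j)) -> x \in c 0 -> ideal (c 0 :\ x) ->
  chain_labels n c T -> chain_labels n (vacated c x) T' -> slide T x T'.
Proof.
move=> cG c_ideal x0 iD0 TL TL'.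
have dG := vacated_growing cG c_ideal x0 iD0.
have nle j z := @vacancy_nle n c x cG c_ideal x0 iD0 j z.
pose S j : tableau Phi Delta := [ffun z => if z \in vacated c x j then T' z
  else if z == vacancy c x j then 0 else T z].
have S0 : S 0 = T.
  apply/ffunP=> z; rewrite ffunE; case: ifPn => [zD | _].
    rewrite (chain_labels_eq0 TL' zD); apply/esym/(chain_labels_eq0 TL).
    by case/setD1P: zD.
  by case: eqP => // ->; apply/esym/(chain_labels_eq0 TL).
have Sn : S n = T'.
  apply/ffunP=> z; rewrite ffunE; case: ifPn => // zD.
  have -> : T' z = 0.
    apply/eqP; rewrite -leqn0 leqNgt; apply/negP=> Tz.
    by have := chain_labels_le z TL' (leqnn n); rewrite Tz TL'.1 (negPf zD).
  case: eqP => // /eqP nzp; apply/eqP; rewrite -leqn0 leqNgt; apply/negP=> Tz.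
  have := chain_labels_le z TL (leqnn n); rewrite Tz TL.1 => /esym/andP[zc _].
  by rewrite !inE nzp zc in zD.
suff slS j : j <= n -> slide (S (n - j)) (vacancy c x (n - j)) T'.
  by have := slS n (leqnn n); rewrite subnn S0.
elim: j => [_ | j IHj lt_jn].
  (* No label is left above the hole, by [vacancy_nle] at [n]. *)
  rewrite subn0 -Sn; apply: SlideStop => y cpy; rewrite Sn.
  apply/eqP; rewrite -leqn0 leqNgt; apply/negP=> Ty.
  have := chain_labels_le y TL' (leqnn n); rewrite Ty TL'.1.
  by rewrite (negPf (nle n y (leqnn n) cpy)).
move: (IHj (ltnW lt_jn)); have -> : n - j = (n - j.+1).+1 by lia.
have: n - j.+1 < n by lia.
move: (n - j.+1) => {IHj lt_jn}i lt_in sl.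
have [nb Dc] := new_boxP x cG lt_in; set b := new_box x c i in nb Dc.
have Tb : T b = i.+1 by exact: (chain_labels_new cG x TL lt_in).
have [pc iD] := vacancy_ideal cG c_ideal x0 iD0 (ltnW lt_in).
set p := vacancy c x i in pc sl *.
have nbp : b != p by apply: contraNneq nb => ->.
have nbD : b \notin vacated c x i by rewrite !inE (negPf nb) andbF.
have npD : p \notin vacated c x i by rewrite !inE eqxx.
have T'new z : z \notin vacated c x i -> z \in vacated c x i.+1 -> T' z = i.+1.
  move=> z1 z2; have z0 : z \notin vacated c x 0.
    by apply: contraNN z1; apply/subsetP/(growingS dG) => //; apply: ltnW.
  have := chain_labels_le z TL' lt_in; have := chain_labels_le z TL' (ltnW lt_in).
  rewrite z2 (negPf z1) z0 /= => /negbT nle_Tz /andP[Tz le_Tz].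
  by apply/eqP; rewrite eqn_leq le_Tz ltnNge; rewrite Tz in nle_Tz.
case: (boolP (cov p b)) => [cpb | ncpb].
  (* The labels still above the hole are greater than [i], and [b] has label
     [i + 1], so [b] is the one that moves. *)
  have vS : vacancy c x i.+1 = b by rewrite /= /next_vacancy cpb.
  have DvS : vacated c x i.+1 = c i by rewrite /vacated vS Dc setU1K.
  apply: (SlideMove cpb); first by rewrite ffunE (negPf nbD) (negPf nbp) Tb.
    move=> z cpz; rewrite !ffunE (negPf nbD) (negPf nbp) Tb.
    have := nle i z (ltnW lt_in) cpz => nzD; rewrite (negPf nzD).
    case: (eqVneq z p) => // nzp Tz; rewrite leqNgt; apply/negP=> lt_Tz.
    have := chain_labels_le z TL (ltnW lt_in); rewrite lt0n Tz -ltnS lt_Tz.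
    by case/esym/andP=> zc _; rewrite !inE nzp zc in nzD.
  suff -> : move_label (S i) b p = S i.+1 by rewrite -vS.
  apply/ffunP=> z; rewrite !ffunE vS (negPf nbD) (negPf nbp) Tb.
  case: (eqVneq z p) => [-> | nzp].
    by rewrite DvS pc T'new // DvS.
  case: (eqVneq z b) => [-> | nzb]; first by rewrite DvS (negPf nb).
  by rewrite DvS !inE nzp.
have vS : vacancy c x i.+1 = p by rewrite /= /next_vacancy (negPf ncpb).
have DvS : vacated c x i.+1 = (b |: c i) :\ p by rewrite /vacated vS Dc.
suff -> : S i = S i.+1 by rewrite -vS.
apply/ffunP=> z; rewrite !ffunE vS -/p.
case: (eqVneq z b) => [-> | nzb].
  rewrite (negPf nbD) (negPf nbp) Tb ifT ?T'new // DvS !inE nbp eqxx //.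
by rewrite DvS !inE (negPf nzb).
Qed.

(** The tableau of the vacated chain is an outcome of the slide, hence the only
one. *)
Lemma slide_chain_labels n c x T T' : growing n c ->
  (forall j, j <= n -> ideal (c j)) -> x \in c 0 -> ideal (c 0 :\ x) ->
  chain_labels n c T -> slide T x T' -> chain_labels n (vacated c x) T'.
Proof.
move=> cG c_ideal x0 iD0 TL sl.
have T2L := chain_tableau_labels (vacated_growing cG c_ideal x0 iD0).
suff -> : T' = chain_tableau n (vacated c x) by [].
apply: slide_deterministic sl _; last exact: slide_vacated T2L.
by move=> y z; apply: chain_labels_inj TL.
Qed.

(** [fominP] along a row: [s'] starts as [s] without [x], and each square
propagates the description of [s'] one step to the right. *)
Lemma fomin_vacated n (s s' : nat -> straight_shape Phi Delta k) x :
  growing n s -> x \in s 0 -> s' 0 = s 0 :\ x :> {set root} ->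
  (forall j, j < n -> fomin_conditions (s j) (s j.+1) (s' j) (s' j.+1)) <->
  (forall j, j <= n -> s' j = vacated s x j :> {set root}).
Proof.
move=> sG x0 s0; have iS (t : straight_shape Phi Delta k) : ideal t by case: t.
have iD0 : ideal (s 0 :\ x) by rewrite -s0.
have step j : j < n -> s' j = vacated s x j :> {set root} ->
    fomin_conditions (s j) (s j.+1) (s' j) (s' j.+1) <->
    s' j.+1 = vacated s x j.+1 :> {set root}.
  move=> lt_jn Ds'; have [nb Db] := new_boxP x sG lt_jn.
  have [pc _] := vacancy_ideal sG (fun j _ => iS (s j)) x0 iD0 (ltnW lt_jn).
  exact: (fominP _ pc Ds' nb Db).
split=> [F | Ds' j lt_jn]; last first.
  by apply/(step j lt_jn (Ds' j (ltnW lt_jn))); apply: Ds'.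
elim=> [_ | j IHj lt_jn]; first exact: s0.
by apply/(step j lt_jn (IHj (ltnW lt_jn))); apply: F.
Qed.

End Slides.

(** * Growth diagrams *)

Theorem theorem2p1 (R : archiRealFieldType) (V : vectType R)
    (dot : {dot V for idfun}%R) (Phi : {fset V}) (r : nat)
    (Delta : r.-tuple V) (k : 'I_r) (m n : nat)
    (g : 'M[straight_shape Phi Delta k]_(m.+1, n.+1)) :
  reduced_root_system dot Phi ->
  simple_roots Phi Delta ->
  cominuscule Phi Delta k ->
  0 < m -> 0 < n ->
  shape_set (g ord_max ord0) = set0 ->
  growth_diagram g <->
  (forall (i i' : 'I_m.+1) (j j' : 'I_n.+1),
     i' = i.+1 :> nat -> j' = j.+1 :> nat ->
     fomin_conditions (g i j) (g i j') (g i' j) (g i' j')).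
Proof.
move=> _ [_ free_Delta _] _ m_gt0 n_gt0 gm0.
(* Natural number indices, so that the lemmas on chains apply to rows. *)
pose s i j : straight_shape Phi Delta k := g (inord i) (inord j).
have sE (i : 'I_m.+1) (j : 'I_n.+1) : g i j = s i j by rewrite /s !inord_val.
have iS (t : straight_shape Phi Delta k) : lower_ideal k t by case: t.
have sm0 : s m 0 = set0 :> {set _}.
  by rewrite -gm0 (sE ord_max ord0).
transitivity (forall i j, i < m -> j < n ->
    fomin_conditions (s i j) (s i j.+1) (s i.+1 j) (s i.+1 j.+1)); last first.
  split=> [F i i' j j' Di Dj | F i j lt_im lt_jn].
    rewrite !sE Di Dj; apply: F; first by rewrite -ltnS -Di.
    by rewrite -ltnS -Dj.
  by apply: F; rewrite !inordK // ltnS // ltnW.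
split=> [[lam [nu [T [A [Ts]]]]] | F].
  move=> [[_ cardl cardn] T_std A_std [Ts0 Ts_slide] gE] i j lt_im lt_jn.
  have Es a b : a <= m -> b <= n ->
      s a b = label_le A (m - a) :|: label_le (Ts a) b :> {set _}.
    by move=> le_a le_b; rewrite gE !inordK.
  have Es0 a : a <= m -> s a 0 = label_le A (m - a) :> {set _}.
    by move=> le_a; rewrite Es // label_le0 setU0.
  have dis_A : [disjoint set0 & lam : {set _}] by rewrite -setI_eq0 set0I.
  have [] := standard_growing dis_A A_std; rewrite cardl !set0U => AG AL Dlam.
  have /card_gt0P[x0 _] : 0 < #|lam| by rewrite cardl.
  (* [x a] is the box labelled [m - a] by [A], into which row [a] is slid. *)
  pose x a := new_box x0 (fun j => set0 :|: label_le A j) (m - a.+1).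
  have xP a : a < m -> [/\ A (x a) = m - a, x a \in s a 0 &
                          s a.+1 0 = s a 0 :\ x a :> {set _}].
    move=> lt_am; have lt : m - a.+1 < m by lia.
    have := chain_labels_new AG x0 AL lt; have := new_boxP x0 AG lt.
    rewrite -/(x a) !set0U -subSn // subSS => -[nx Dx] Ax.
    by rewrite !Es0 ?(ltnW lt_am) // Dx setU11 setU1K.
  have next a : a < m -> growing n (s a) -> chain_labels n (s a) (Ts a) ->
      let v := vacated (s a) (x a) in
      [/\ growing n v, chain_labels n v (Ts a.+1) &
          forall b, b <= n -> v b = s a.+1 b].
    move=> lt_am sG sL v; have [Ax xs Ds] := xP a lt_am.
    have iD : lower_ideal k (s a 0 :\ x a) by rewrite -Ds.
    have vG : growing n v by apply: vacated_growing iD.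
    have vL : chain_labels n v (Ts a.+1).
      by apply: slide_chain_labels iD sL (Ts_slide a (x a) lt_am Ax).
    split=> // b le_b; rewrite Es // -Es0 // Ds vL.2 //.
    have sub : v 0 \subset v b by apply: growingS vG _ le_b.
    by rewrite -[LHS](setID _ (v 0)) (setIidPr sub).
  have rows a : a <= m -> growing n (s a) /\ chain_labels n (s a) (Ts a).
    elim: a => [_ | a IHa lt_am].
      have dis_T : [disjoint lam : {set _} & nu :\: lam].
        by rewrite disjoint_sym disjoints_subset setDE subsetIr.
      have [] := standard_growing dis_T T_std.
      rewrite cardn => G L _; have eq0 b : b <= n -> lam :|: label_le T b = s 0 b.
        by move=> le_b; rewrite Es // subn0 Dlam Ts0.
      by split; [apply: growing_ext eq0 G | rewrite Ts0; apply: chain_labels_ext eq0 L].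
    have [sG sL] := IHa (ltnW lt_am); have [vG vL eq_v] := next a lt_am sG sL.
    by split; [apply: growing_ext eq_v vG | apply: chain_labels_ext eq_v vL].
  have [sG sL] := rows i (ltnW lt_im); have [_ xs Ds] := xP i lt_im.
  have [_ _ eq_v] := next i lt_im sG sL.
  by apply: (fomin_vacated free_Delta sG xs Ds).2 j lt_jn => b /eq_v.
have top_box i j : i < m -> j < n -> one_box (s i j) (s i j.+1).
  by move=> lt_im lt_jn; have [[]] := F i j lt_im lt_jn.
have left_box i : i < m -> one_box (s i.+1 0) (s i 0).
  by move=> lt_im; have [[]] := F i 0 lt_im n_gt0.
have row_growing i : i <= m -> growing n (s i).
  rewrite leq_eqVlt => /predU1P[-> | lt_im] j lt_jn; last exact: top_box.
  have lt_m : m.-1 < m by rewrite prednK.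
  by have [[]] := F m.-1 j lt_m lt_jn; rewrite (prednK m_gt0).
(* The left column read upwards is the chain of [A]. *)
pose col i := shape_set (s (m - i) 0).
have col_growing : growing m col.
  move=> i lt_im; have := left_box (m - i.+1).
  by rewrite -subSn // subSS /col; apply; lia.
have col0 : col 0 = set0 by rewrite /col subn0.
have colm : col m = s 0 0 by rewrite /col subnn.
pose A := chain_tableau m col; pose Ts i := chain_tableau n (s i).
have AL : chain_labels m col A by apply: chain_tableau_labels.
have TsL i : i <= m -> chain_labels n (s i) (Ts i).
  by move/row_growing=> sG; apply: chain_tableau_labels.
have AE i : i <= m -> label_le A (m - i) = s i 0.
  by move=> le_im; rewrite AL.2 ?leq_subr // col0 setD0 /col subKn.
exists (s 0 0), (s 0 n), (Ts 0), A, Ts; split.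
- split; first exact: growingS (row_growing 0 isT) _ _.
    by have := growing_card col_growing; rewrite col0 setD0 colm.
  exact: growing_card (row_growing 0 isT).
- exact: (standard_chain_labels (row_growing 0 isT) (fun j _ => iS (s 0 j))
    (TsL 0 isT)).
- rewrite -[shape_set _]setD0 -col0 -colm.
  exact: (standard_chain_labels col_growing (fun j _ => iS (s (m - j) 0)) AL).
- split=> // i x lt_im Ax.
  have xs : x \in s i 0 by rewrite -AE ?inE ?Ax; lia.
  have nxs : x \notin s i.+1 0 by rewrite -AE // inE Ax; lia.
  have Ds := one_box_setD1 (left_box i lt_im) xs nxs.
  have sG := row_growing i (ltnW lt_im).
  have eq_s := (fomin_vacated free_Delta sG xs Ds).1 (fun j => F i j lt_im).
  have iD : lower_ideal k (s i 0 :\ x) by rewrite -Ds.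
  apply: (slide_vacated free_Delta sG (fun j _ => iS (s i j)) xs iD
    (TsL i (ltnW lt_im))).
  exact: chain_labels_ext eq_s (TsL i.+1 lt_im).
move=> i j; have [le_im le_jn] : i <= m /\ j <= n by split; rewrite -ltnS.
rewrite sE AE // (TsL i le_im).2 //.
have sub : s i 0 \subset s i j by apply: growingS (row_growing i le_im) _ le_jn.
by rewrite -[LHS](setID _ (s i 0)) (setIidPr sub).
Qed.
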